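(* For all integers $k\geq 2$ and $n\geq 1$ there exists an integer $m=m(k,n)$ such that for every finite $(k+k)$-free poset $P$ whose cover graph does not contain $K_n$ as a topological minor, and every positive integer $d$, if $P$ contains the standard example $S_d$ as a subposet, then $d\leq m$.
   Context: All posets are finite. A poset $P$ is $(k+k)$-free if it does not contain points $a_1,\ldots,a_k,b_1,\ldots,b_k$ such that $a_1<\cdots<a_k$ in $P$, $b_1<\cdots<b_k$ in $P$, and $a_i$ is incomparable to $b_j$ in $P$ for all $i,j\in\{1,\ldots,k\}$. The standard example $S_d$ is the poset on $d$ minimal elements $a_1,\ldots,a_d$ and $d$ maximal elements $b_1,\ldots,b_d$ ($2d$ distinct elements) such that $a_i<b_j$ in $S_d$ if and only if $i\neq j$ (and there are no other strict relations). A poset $P$ contains $S_d$ as a subposet if some subset of the points of $P$, with the order induced from $P$, is isomorphic to $S_d$. For distinct points $x,y$, the point $x$ is covered by $y$ in $P$ if $x<y$ in $P$ and there is no $z\in P$ with $x<z<y$ in $P$. The cover graph of $P$ is the undirected graph whose vertices are the points of $P$ and whose edges join $x$ and $y$ whenever one of them is covered by the other. $K_n$ is the complete graph on $n$ vertices. A subdivision of a graph $H$ is a graph $H'$ obtained from $H$ by replacing edges by paths: $H'$ contains all vertices of $H$, each edge $e$ of $H$ corresponds to a path $P_e$ in $H'$ between the endpoints of $e$ whose interior avoids the vertices of $H$, the paths $P_e,P_f$ are internally disjoint for distinct edges $e,f$ of $H$, and $H'$ consists exactly of the vertices of $H$ and these paths. A graph $H$ is a topological minor of $G$ if $G$ contains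 a subdivision of $H$ as a subgraph. *)

(* Defs.v *)
From HB Require Import structures.
From mathcomp Require Import all_boot all_order.

Set Implicit Arguments.
Unset Strict Implicit.
Unset Printing Implicit Defensive.

Import Order.TTheory.
Local Open Scope order_scope.

Record simple_graph := SimpleGraph {
  vertex :> finType;
  adj : rel vertex;
  adj_sym : symmetric adj;
  adj_irrefl : irreflexive adj
}.

Definition subgraph (H G : simple_graph) : Prop :=
  exists2 f : H -> G, injective f & forall x y, adj x y -> adj (f x) (f y).

(* [br] embeds the vertices of [H] in [H'].  For an edge [uv] of [H], [p u v]
   lists the interior of the path replacing [uv], read from [br u] to [br v];
   [p v u] is the same path read backwards.  Values of [p] on non-edges are
   irrelevant. *)
Definition subdivision_path (H H' : simple_graph) (br : H -> H')
    (p : H -> H -> seq H') (u v : H) : seq H' :=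
  br u :: rcons (p u v) (br v).

Definition subdivision (H H' : simple_graph) : Prop :=
  exists (br : H -> H') (p : H -> H -> seq H'),
    injective br /\
    (forall u v, adj u v -> p v u = rev (p u v)) /\
    (forall u v, adj u v ->
       sorted (@adj H') (subdivision_path br p u v) /\
       uniq (subdivision_path br p u v)) /\
    (forall u v w, adj u v -> br w \notin p u v) /\
    (forall u v u' v' x, adj u v -> adj u' v' ->
       x \in p u v -> x \in p u' v' ->
       (u = u' /\ v = v') \/ (u = v' /\ v = u')) /\
    (forall x : H', (exists u, x = br u) \/
       (exists u v, adj u v /\ x \in p u v)) /\
    (forall x y : H', adj x y ->
       exists u v, adj u v /\ infix [:: x; y] (subdivision_path br p u v)).

Definition topological_minor (H G : simple_graph) : Prop :=
  exists2 H' : simple_graph, subdivision H H' & subgraph H' G.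

Section CompleteGraph.
Variable n : nat.

Definition complete_adj : rel 'I_n := fun i j => i != j.

Fact complete_adj_sym : symmetric complete_adj.
Proof. by move=> i j; rewrite /complete_adj eq_sym. Qed.

Fact complete_adj_irrefl : irreflexive complete_adj.
Proof. by move=> i; rewrite /complete_adj eqxx. Qed.

Definition complete_graph : simple_graph :=
  SimpleGraph complete_adj_sym complete_adj_irrefl.
End CompleteGraph.

Section CoverGraph.
Variables (disp : Order.disp_t) (P : finPOrderType disp).

Definition covered_by (x y : P) : bool :=
  (x < y) && ~~ [exists z : P, (x < z) && (z < y)].

Definition cover_adj : rel P := fun x y => covered_by x y || covered_by y x.

Fact cover_adj_sym : symmetric cover_adj.
Proof. by move=> x y; rewrite /cover_adj orbC. Qed.

Fact cover_adj_irrefl : irreflexive cover_adj.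
Proof. by move=> x; rewrite /cover_adj /covered_by ltxx. Qed.

Definition cover_graph : simple_graph :=
  SimpleGraph cover_adj_sym cover_adj_irrefl.
End CoverGraph.

(* In [x >< y], [x] and [y] are in particular distinct. *)
Definition kk_free (k : nat) (disp : Order.disp_t) (P : finPOrderType disp) :
    Prop :=
  ~ exists a b : 'I_k -> P,
      (forall i j : 'I_k, (i < j)%N -> a i < a j) /\
      (forall i j : 'I_k, (i < j)%N -> b i < b j) /\
      (forall i j : 'I_k, a i >< b j).

(* [inl i] is the minimal element a_i and [inr j] the maximal element b_j. *)
Definition std_example (d : nat) : Type := ('I_d + 'I_d)%type.

HB.instance Definition _ (d : nat) :=
  Finite.copy (std_example d) ('I_d + 'I_d)%type.

Section StdExample.
Variable d : nat.

Definition std_example_lt : rel (std_example d) := fun x y =>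
  match x, y with
  | inl i, inr j => i != j
  | _, _ => false
  end.

Fact std_example_lt_irr : irreflexive std_example_lt.
Proof. by case. Qed.

Fact std_example_lt_trans : transitive std_example_lt.
Proof. by move=> [y|y] [x|x] [z|z]. Qed.

HB.instance Definition _ :=
  Order.Lt_isPOrder.Build (Order.Disp tt tt) (std_example d)
    std_example_lt_irr std_example_lt_trans.
End StdExample.

(* The subset of [P] is the image of [f], with the induced order. *)
Definition contains_subposet (dispQ dispP : Order.disp_t)
    (Q : finPOrderType dispQ) (P : finPOrderType dispP) : Prop :=
  exists2 f : Q -> P, injective f & {mono f : x y / x <= y}.

(* Main.v *)
Require Import Defs.
From mathcomp Require Import all_boot all_order.

(** Write a_i, b_j for the points of the standard example.  If z lies between
a_i and b_j, and w between a_j and b_i, then z and w are incomparable, since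
z <= w would give a_i <= b_i.  Hence every chain from a_i to b_j is
incomparable to every chain from a_j to b_i, and in a (k+k)-free poset one of
the two intervals contains no chain of k points ([kk_free_chain_free]).
Ramsey's theorem for pairs then gives a long ladder: a sequence of pairs
(x_i, y_i) with x_i not below y_i, and such that for i < j we have x_i <= y_j
and no chain of k points between x_i and y_j.

A long ladder forces a subdivision of K_n ([long_ladder_topological_minor]), by
induction on k.  Fix a path c_ij of covers from x_i to y_j for i < j.  Colour a
triple i < j < l by whether some vertex of c_ij other than x_i is below y_l, and
at which position, and by whether some vertex of c_jl other than y_l is above
x_i, and at which position.  Ramsey's theorem for triples makes the colour
constant.
- If a vertex of c_ij at a fixed position is below all later y_l, it can replace
  x_i ([ladder_raise]): the intervals lose their bottom element, so k drops.
- If a vertex of c_jl at a fixed position is above all earlier x_i, it can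
  likewise replace y_l ([ladder_lower]).
- Otherwise, for i, i' well before j, j', two distinct paths c_ij and c_i'j' meet
  only in a common end x_i or y_j ([untangled_topological_minor]).  Then
  x_1, ..., x_n are the branch vertices, and x_u is joined to x_v through a y
  reserved for the pair {u, v} ([subdivided_biclique_topological_minor]). *)

Set Implicit Arguments.
Unset Strict Implicit.
Unset Printing Implicit Defensive.

Import Order.TTheory.

(** * Ramsey's theorem for subsequences of a fixed length *)

Lemma pigeonhole_count (T : Type) (C : finType) (g : T -> C) m (w : seq T) :
  #|C| * m < size w -> exists c, m < count (fun p => g p == c) w.
Proof.
have -> : size w = \sum_c count (fun p => g p == c) w.
  elim: w => [|p w IHw] /=; first by rewrite big1.
  rewrite big_split /= -IHw (bigD1 (g p)) //= eqxx big1 ?addn0 // => c.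
  by rewrite eq_sym => /negbTE->.
move=> lt_m; apply/existsP; apply: contraLR lt_m; rewrite negb_exists -leqNgt.
move=> /forallP le_m; rewrite -sum_nat_const.
by apply: leq_sum => c _; rewrite leqNgt.
Qed.

(** Hypergraph edges are the length-[r] subsequences of [s], which keeps the
linear order of the indices visible; [T] is quantified after [N] so that the
bound does not depend on the poset. *)
Definition ramsey_at (C : finType) r := forall m, exists N,
  forall (T : eqType) (f : seq T -> C) (s : seq T), N <= size s ->
  exists t c, [/\ subseq t s, size t = m &
    forall u, subseq u t -> size u = r -> f u = c].

(** The usual intermediate stage in the step from [r] to [r + 1]: picking the
head and passing to a subsequence of the tail on which the induced [r]-colouring
is constant, over and over, makes the colour of an edge depend on its first
element only.  That colour is stored next to the element. *)
Lemma ramsey_heads (C : finType) r : ramsey_at C r -> forall M, exists N,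
  forall (T : eqType) (f : seq T -> C) (s : seq T), N <= size s ->
  exists w : seq (T * C), [/\ subseq (map fst w) s, size w = M &
    forall p u, subseq (p :: u) w -> size u = r -> f (map fst (p :: u)) = p.2].
Proof.
move=> ramsey_r; elim=> [|M [N0 IHM]].
  by exists 0 => T f s _; exists [::]; split=> //; rewrite sub0seq.
have [N1 ramseyN1] := ramsey_r N0.
exists N1.+1 => T f [|x s] //= le_s.
have [t [c [t_s sz_t ft]]] := ramseyN1 _ (fun u => f (x :: u)) s le_s.
have [|w [w_t sz_w fw]] := IHM _ f t; first by rewrite sz_t.
exists ((x, c) :: w); split=> [||p u] /=; rewrite ?eqxx ?sz_w //.
  exact: subseq_trans t_s.
case: eqP => [-> u_w sz_u | _]; last exact: fw.
by rewrite ft ?size_map //; apply: subseq_trans w_t; apply: map_subseq.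
Qed.

Theorem ramsey (C : finType) r : ramsey_at C r.
Proof.
elim: r => [|r IHr] m.
  exists m => T f s le_s; exists (take m s), (f [::]).
  by split=> [||u _ /size0nil->//]; rewrite ?take_subseq ?size_takel.
have [N headsN] := ramsey_heads IHr (#|C| * m).+1.
exists N => T f s /headsN-/(_ f)[w [w_s sz_w fw]].
have [|c lt_c] := @pigeonhole_count _ C snd m w; first by rewrite sz_w.
pose w' := take m (filter (fun p => p.2 == c) w).
have w'_w : subseq w' w by apply: subseq_trans (take_subseq _ _) (filter_subseq _ _).
exists (map fst w'), c; split.
- exact: subseq_trans (map_subseq _ w'_w) w_s.
- by rewrite size_map size_takel // size_filter ltnW.
move=> _ /subseqP[b _ ->]; rewrite -map_mask; set v := mask b w'.
have v_w' : subseq v w' by apply: mask_subseq.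
have : all (fun p => p.2 == c) v.
  by apply/allP=> p /(mem_subseq v_w')/mem_take; rewrite mem_filter => /andP[].
case: v v_w' => // p v v_w' /andP[/eqP<- _] [sz_v].
by apply: fw; rewrite ?(subseq_trans v_w') // -(size_map fst).
Qed.

Lemma subseq_nth (T : eqType) (x0 : T) (s : seq T) (js : seq nat) :
  sorted ltn js -> all (gtn (size s)) js -> subseq (map (nth x0 s) js) s.
Proof.
move=> js_lt /allP js_s.
rewrite -[X in subseq _ X](mkseq_nth x0) /mkseq.
suff -> : js = filter (mem js) (iota 0 (size s)) by rewrite map_subseq ?filter_subseq.
apply: (irr_sorted_eq ltn_trans ltnn) => //.
  by rewrite sorted_filter ?iota_ltn_sorted //; apply: ltn_trans.
move=> j; rewrite mem_filter mem_iota /=.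
by case: (boolP (j \in js)) => // /js_s /= ->.
Qed.

Lemma subseq2_nth (T : eqType) (x0 u v : T) (s : seq T) :
  subseq [:: u; v] s ->
  exists i j, [/\ i < j, j < size s, u = nth x0 s i & v = nth x0 s j].
Proof.
elim: s => //= a s IHs; case: eqP => [<-|_ /IHs[i [j [? ? ? ?]]]]; last by exists i.+1, j.+1.
rewrite sub1seq => v_s; exists 0, (index v s).+1.
by rewrite ltnS [in size _]/= ltnS index_mem /= nth_index.
Qed.

(** The last clause separates adjacent entries, which share an argument of [g],
from entries further apart. *)
Lemma subseq2_pairmap (T S : eqType) (g : T -> T -> S) p0 t u v :
  subseq [:: u; v] (pairmap g p0 t) ->
  exists a b c d, [/\ u = g a b, v = g c d, subseq [:: a; b] (p0 :: t),
    subseq [:: c; d] (p0 :: t) &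
    b = c \/ subseq [:: a; b; c] (p0 :: t) /\ subseq [:: b; c; d] (p0 :: t)].
Proof.
move=> /(subseq2_nth u)[i [j [ij]]]; rewrite size_pairmap => jt.
have it := ltn_trans ij jt.
rewrite !(nth_pairmap p0) // => eq_u eq_v; pose a i := nth p0 (p0 :: t) i.
exists (a i), (a i.+1), (a j), (a j.+1); split=> //.
- apply: (@subseq_nth _ p0 (p0 :: t) [:: i; i.+1]) => /=; first by rewrite ltnSn.
  by rewrite !ltnS it ltnW.
- apply: (@subseq_nth _ p0 (p0 :: t) [:: j; j.+1]) => /=; first by rewrite ltnSn.
  by rewrite !ltnS jt ltnW.
move: ij; rewrite leq_eqVlt => /predU1P[<-|ij]; [by left | right].
split.
  apply: (@subseq_nth _ p0 (p0 :: t) [:: i; i.+1; j]) => /=; first by rewrite ltnSn ij.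
  by rewrite !ltnS (ltnW it) it ltnW.
apply: (@subseq_nth _ p0 (p0 :: t) [:: i.+1; j; j.+1]) => /=; first by rewrite ltnSn ij.
by rewrite !ltnS it jt (ltnW jt).
Qed.

Lemma mem_pairmap (T S : eqType) (g : T -> T -> S) p0 t u :
  u \in pairmap g p0 t -> exists a b, u = g a b /\ subseq [:: a; b] (p0 :: t).
Proof.
move=> /(nthP u)[i]; rewrite size_pairmap => it <-; rewrite (nth_pairmap p0) //.
exists (nth p0 (p0 :: t) i), (nth p0 (p0 :: t) i.+1); split=> //.
apply: (@subseq_nth _ p0 (p0 :: t) [:: i; i.+1]) => /=; first by rewrite ltnSn.
by rewrite !ltnS it ltnW.
Qed.

Lemma subseq_skip_middle (T : eqType) (x y z : T) : subseq [:: x; z] [:: x; y; z].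
Proof. exact: (mask_subseq [:: true; false; true] [:: x; y; z]). Qed.

(** * Topological minors from systems of paths *)

Lemma sorted_rev_adj (G : simple_graph) (s : seq G) :
  sorted (@adj G) (rev s) = sorted (@adj G) s.
Proof. by rewrite rev_sorted; apply: eq_sorted => x y; rewrite adj_sym. Qed.

Lemma sorted_consecutive (T : Type) (e : rel T) (s : seq T) :
  (forall s1 x y s2, s = s1 ++ [:: x, y & s2] -> e x y) ->
  sorted e s.
Proof.
elim: s => // x [|y s] IHs //= e_s; rewrite (e_s [::] x y s) //=.
by apply: IHs => s1 z t s2 eq_s; apply: (e_s (x :: s1) z t s2); rewrite eq_s.
Qed.

Section Subdivision.
Variables (H G : simple_graph) (br : H -> G) (p : H -> H -> seq G).
Hypothesis br_inj : injective br.
Hypothesis p_rev : forall u v, adj u v -> p v u = rev (p u v).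
Hypothesis p_path : forall u v, adj u v ->
  sorted (@adj G) (subdivision_path br p u v) /\ uniq (subdivision_path br p u v).
Hypothesis p_br : forall u v w, adj u v -> br w \notin p u v.
Hypothesis p_disj : forall u v u' v' x, adj u v -> adj u' v' ->
  x \in p u v -> x \in p u' v' -> (u = u' /\ v = v') \/ (u = v' /\ v = u').

Let used : pred G := [pred x |
  [exists u, x == br u] || [exists u, exists v, adj u v && (x \in p u v)]].

Let V : finType := {x : G | used x}.

Let e : rel V := fun x y =>
  [exists u, exists v, adj u v && infix [:: val x; val y] (subdivision_path br p u v)].

Let path_rev u v : adj u v -> subdivision_path br p v u = rev (subdivision_path br p u v).
Proof. by move=> uv; rewrite /subdivision_path (p_rev uv) rev_cons rev_rcons. Qed.

Let e_sym : symmetric e.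
Proof.
suff e_sub x y : e x y -> e y x by move=> x y; apply/idP/idP; apply: e_sub.
move=> /existsP[u /existsP[v /andP[uv xy]]]; apply/existsP; exists v; apply/existsP; exists u.
by rewrite adj_sym uv path_rev // -[X in infix X _]/(rev [:: val x; val y]) infix_rev.
Qed.

Let e_adj x y : e x y -> adj (val x) (val y).
Proof.
move=> /existsP[u /existsP[v /andP[uv /infixP[s1 [s2 eq_uv]]]]].
have [] := p_path uv; rewrite eq_uv => + _.
by rewrite sorted_cat_cons /= => /andP[_ /andP[->]].
Qed.

Let e_irr : irreflexive e.
Proof. by move=> x; case e_xx: (e x x) => //; rewrite -(adj_irrefl (val x)) e_adj. Qed.

Let br_used u : used (br u).
Proof. by apply/orP; left; apply/existsP; exists u. Qed.

Let p_used u v x : adj u v -> x \in p u v -> used x.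
Proof.
move=> uv x_uv; apply/orP; right; apply/existsP; exists u.
by apply/existsP; exists v; rewrite uv.
Qed.

Let lift_p u v : adj u v -> map val (pmap insub (p u v) : seq V) = p u v.
Proof.
move=> uv; rewrite pmap_filter; last exact: insubK.
by apply/all_filterP/allP=> x x_uv; rewrite isSome_insub (p_used uv).
Qed.

(** The remaining two conditions in the definition of a subdivision, that the
paths exhaust the vertices and the edges, hold by construction once the graph is
cut down to the union of the paths. *)
Lemma topological_minor_intro : topological_minor H G.
Proof.
pose H' := SimpleGraph e_sym e_irr.
pose br' u : H' := Sub (br u) (br_used u).
pose p' u v : seq H' := pmap insub (p u v).
have val_path u v : adj u v ->
    map val (subdivision_path br' p' u v) = subdivision_path br p u v.
  by move=> uv; rewrite /subdivision_path /= map_rcons lift_p.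
have mem_p' u v x : adj u v -> (x \in p' u v) = (val x \in p u v).
  by move=> uv; rewrite -[in RHS]lift_p // mem_map //; apply: val_inj.
exists H'; last by exists (val : H' -> G); [exact: val_inj | move=> x y; exact: e_adj].
exists br', p'; split; first by move=> u v /(congr1 val)/br_inj.
split.
  move=> u v uv; apply: (inj_map val_inj); rewrite map_rev (lift_p uv) lift_p.
    exact: p_rev.
  by rewrite adj_sym.
split.
  move=> u v uv; split; last by rewrite -(map_inj_uniq val_inj) val_path //; case: (p_path uv).
  apply: sorted_consecutive => s1 x y s2 eq_uv; apply/existsP; exists u.
  apply/existsP; exists v.
  rewrite uv -val_path // eq_uv map_cat /=; apply/infixP.
  by exists (map val s1), (map val s2).
split; first by move=> u v w uv; rewrite mem_p' //; apply: p_br.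
split; first by move=> u v u' v' x uv uv'; rewrite !mem_p' //; apply: p_disj.
split.
  move=> x; case/orP: (valP x) => [/existsP[u /eqP x_u]|].
    by left; exists u; apply: val_inj.
  move=> /existsP[u /existsP[v /andP[uv x_uv]]].
  by right; exists u, v; rewrite mem_p'.
move=> x y /existsP[u /existsP[v /andP[uv /infixP[s1 [s2 eq_uv]]]]]; exists u, v; split=> //.
apply/infixP; exists (take (size s1) (subdivision_path br' p' u v)).
exists (drop (size s1).+2 (subdivision_path br' p' u v)).
apply: (inj_map val_inj); rewrite !map_cat map_take map_drop val_path // eq_uv /=.
by rewrite take_size_cat // drop_cat ltnNge leqW 1?leqW // -addn2 addKn /= drop0.
Qed.
End Subdivision.

(** The graph contains a subdivision of the complete bipartite graph between the
branch vertices [x] and the hubs [y]; reserving a hub [h u v] for each unordered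
pair and using it as the midpoint of the path from [x u] to [x v] subdivides the
complete graph. *)
Lemma subdivided_biclique_topological_minor (G : simple_graph) n
    (J : Type) (x : 'I_n -> G) (y : J -> G) (e : 'I_n -> J -> seq G) (h : 'I_n -> 'I_n -> J) :
  (forall u v, h u v = h v u) ->
  (forall u v u' v', h u v = h u' v' -> (u = u' /\ v = v') \/ (u = v' /\ v = u')) ->
  (forall u j, sorted (@adj G) (x u :: rcons (e u j) (y j))) ->
  (forall u j, uniq (x u :: rcons (e u j) (y j))) ->
  (forall u j u' j' z, z \in x u :: rcons (e u j) (y j) ->
      z \in x u' :: rcons (e u' j') (y j') ->
      [\/ u = u' /\ j = j', u = u' /\ z = x u | j = j' /\ z = y j]) ->
  topological_minor (complete_graph n) G.
Proof.
move=> h_sym h_inj e_path e_uniq e_disj.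
have xNe u j : x u \notin rcons (e u j) (y j) by have /andP[] := e_uniq u j.
have yNe u j : y j \notin x u :: e u j.
  by have := e_uniq u j; rewrite -rcons_cons rcons_uniq => /andP[].
have y_in u j : y j \in x u :: rcons (e u j) (y j) by rewrite inE mem_rcons mem_head orbT.
(* Otherwise x w lies on the path from x u and on its own path to the same hub;
   hence it is x u or y j, but each path visits its ends only once. *)
have xNe' u w j : x w \notin rcons (e u j) (y j).
  apply/negP => xw_e; case: (e_disj u j w j (x w)); rewrite ?mem_head ?inE ?xw_e ?orbT //.
  - by case=> eq_uw _; rewrite -eq_uw (negbTE (xNe _ _)) in xw_e.
  - by case=> eq_uw _; rewrite -eq_uw (negbTE (xNe _ _)) in xw_e.
  by case=> _ /esym eq_y; have := yNe w j; rewrite eq_y mem_head.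
pose p u v := e u (h u v) ++ y (h u v) :: rev (e v (h u v)).
have p_rev u v : p v u = rev (p u v).
  by rewrite /p h_sym rev_cat rev_cons revK -cats1 -catA.
have p_mem u v z : z \in p u v ->
    z \in rcons (e u (h u v)) (y (h u v)) \/ z \in rcons (e v (h v u)) (y (h v u)).
  rewrite /p mem_cat inE mem_rev (h_sym v u) !mem_rcons !inE.
  by case/or3P=> ->; rewrite ?orbT; [left | left | right].
have path_eq u v : @subdivision_path (complete_graph n) G x p u v =
    (x u :: rcons (e u (h u v)) (y (h u v))) ++ rev (x v :: e v (h u v)).
  by rewrite /subdivision_path /p rcons_cat rcons_cons -rev_cons cat_cons cat_rcons.
apply: (@topological_minor_intro (complete_graph n) G x p).
- move=> u v eq_x; case: (e_disj u (h u v) v (h u v) (x u));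
    rewrite ?mem_head 1?eq_x ?mem_head //.
  + by case.
  + by case.
  by case=> _ eq_y; have := yNe v (h u v); rewrite -eq_y mem_head.
- by move=> u v _; apply: p_rev.
- move=> u v; change (adj u v) with (u != v) => uv; rewrite path_eq; set j := h u v.
  split.
    rewrite cat_cons cat_rcons -cat_cons sorted_cat_cons rcons_cons e_path /=.
    rewrite -[path _ _ _]/(sorted _ (_ :: _)) -rev_rcons sorted_rev_adj rcons_cons.
    exact: e_path.
  rewrite cat_uniq rev_uniq; apply/and3P; split; first exact: e_uniq.
    apply/hasPn=> z; rewrite mem_rev => z_v; apply/negP=> z_u.
    case: (e_disj u j v j z) => //.
    + by rewrite -rcons_cons mem_rcons inE z_v orbT.
    + by case=> eq_uv; rewrite eq_uv eqxx in uv.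
    + by case=> eq_uv; rewrite eq_uv eqxx in uv.
    by case=> _ eq_z; rewrite eq_z (negbTE (yNe _ _)) in z_v.
  by have := e_uniq v j; rewrite -rcons_cons rcons_uniq => /andP[].
- by move=> u v w _; apply/negP => /p_mem[]; rewrite (negbTE (xNe' _ _ _)).
have disj u v u' v' z : z \in rcons (e u (h u v)) (y (h u v)) ->
    z \in rcons (e u' (h u' v')) (y (h u' v')) ->
    (u = u' /\ v = v') \/ (u = v' /\ v = u').
  move=> z_u z_u'; case: (e_disj u (h u v) u' (h u' v') z); rewrite ?inE ?z_u ?z_u' ?orbT //.
  + by case=> _ /h_inj.
  + by case=> _ eq_z; rewrite eq_z (negbTE (xNe' _ _ _)) in z_u.
  by case=> /h_inj.
by move=> u v u' v' z _ _ /p_mem[] z1 /p_mem[] z2; have := disj _ _ _ _ _ z1 z2; tauto.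
Qed.

Local Open Scope order_scope.

(** * Short intervals and ladders *)

Section Chains.
Variables (disp : Order.disp_t) (P : finPOrderType disp).
Implicit Types (x y z : P) (c : seq P) (k : nat).

Definition chain_free k x y :=
  ~~ [exists c : k.-tuple P, sorted <%O c && all (fun z => x <= z <= y) c].

Lemma chain_free_size k x y c : chain_free k x y ->
  sorted <%O c -> all (fun z => x <= z <= y) c -> (size c < k)%N.
Proof.
move=> free_k c_lt c_xy; rewrite ltnNge; apply: contra free_k => le_k.
have sz_c : size (take k c) == k by rewrite size_takel.
apply/existsP; exists (Tuple sz_c); rewrite take_sorted //=.
by apply/allP=> z /mem_take; apply: (allP c_xy).
Qed.

Lemma chain_freeI k x y :
  (forall c, size c = k -> sorted <%O c -> all (fun z => x <= z <= y) c -> False) ->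
  chain_free k x y.
Proof.
by move=> H; apply/existsP=> -[c /andP[c_lt c_xy]]; apply: (H c) => //; rewrite size_tuple.
Qed.

(** A chain above [x'] can be extended downwards by [x]. *)
Lemma chain_free_raise k x x' y : x < x' -> x' <= y ->
  chain_free k.+1 x y -> chain_free k x' y.
Proof.
move=> xx' x'y free_k; apply: chain_freeI => c sz_c c_lt c_xy.
suff : (size (x :: c) < k.+1)%N by rewrite /= sz_c ltnn.
apply: (chain_free_size free_k) => /=.
  case: c c_lt c_xy {sz_c} => //= z c -> /andP[/andP[x'z _] _].
  by rewrite (lt_le_trans xx').
rewrite lexx (le_trans (ltW xx')) //=; apply: sub_all c_xy => z /andP[x'z ->].
by rewrite (le_trans (ltW xx')).
Qed.

Lemma chain_free_lower k x y y' : y' < y -> x <= y' ->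
  chain_free k.+1 x y -> chain_free k x y'.
Proof.
move=> y'y xy' free_k; apply: chain_freeI => c sz_c c_lt c_xy.
suff : (size (rcons c y) < k.+1)%N by rewrite size_rcons sz_c ltnn.
apply: (chain_free_size free_k).
  case: c c_lt c_xy {sz_c} => //= z c c_lt /= c_xy.
  rewrite rcons_path c_lt /=; apply: le_lt_trans y'y.
  by have /andP[] := allP (c_xy : all (fun t => x <= t <= y') (z :: c)) _ (mem_last z c).
rewrite all_rcons lexx (le_trans xy') ?ltW //=; apply: sub_all c_xy => z /andP[-> zy'].
by rewrite (le_trans zy') ?ltW.
Qed.

Lemma cover_path_exists x y : x <= y ->
  exists c, path (@covered_by _ P) x c && (last x c == y).
Proof.
have [n] := ubnP #|[pred z | x < z & z < y]|.
elim: n x y => // n IHn x y; rewrite ltnS => le_n.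
rewrite le_eqVlt => /predU1P[<-|xy]; first by exists [::]; rewrite /= eqxx.
have [/existsP[z /andP[xz zy]]|xy_cov] := boolP [exists z, (x < z) && (z < y)]; last first.
  by exists [:: y]; rewrite /= eqxx /covered_by xy xy_cov.
have [|c1 /andP[c1_path /eqP c1_last]] := IHn x z _ (ltW xz).
  apply: leq_trans le_n; apply/proper_card/properP; split.
    by apply/subsetP => w; rewrite !inE => /andP[-> /lt_trans->].
  by exists z; rewrite !inE ?xz ?zy ?ltxx ?andbF.
have [|c2 /andP[c2_path c2_last]] := IHn z y _ (ltW zy).
  apply: leq_trans le_n; apply/proper_card/properP; split.
    by apply/subsetP => w; rewrite !inE => /andP[/(lt_trans xz)-> ->].
  by exists z; rewrite !inE ?xz ?zy ?ltxx ?andbF.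
by exists (c1 ++ c2); rewrite cat_path last_cat c1_path c1_last c2_path.
Qed.

(** The starting point [x] is left out of the list, as in [path]. *)
Definition cover_path x y : seq P :=
  if @idP (x <= y) is ReflectT le_xy then xchoose (cover_path_exists le_xy)
  else [::].

Lemma cover_pathP x y : x <= y ->
  path (@covered_by _ P) x (cover_path x y) /\ last x (cover_path x y) = y.
Proof.
rewrite /cover_path; case: {-}_ / idP => // le_xy _.
by have /andP[? /eqP] := xchooseP (cover_path_exists le_xy).
Qed.

Lemma cover_path_lt x y : x <= y -> path <%O x (cover_path x y).
Proof. by case/cover_pathP=> + _; apply: sub_path => z t /andP[]. Qed.

Lemma cover_path_head x y z : x <= y -> z \in cover_path x y -> x < z.
Proof. by move=> /cover_path_lt/(order_path_min lt_trans)/allP; apply. Qed.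

Lemma cover_path_last x y z : x <= y -> z \in belast x (cover_path x y) -> z < y.
Proof.
move=> xy z_in; have [_ lastE] := cover_pathP xy.
have : sorted <%O (x :: cover_path x y) := cover_path_lt xy.
rewrite lastI lastE sorted_pairwise; last exact: lt_trans.
by rewrite pairwise_rcons => /andP[/allP/(_ _ z_in)].
Qed.

Lemma cover_path_between x y z : x <= y -> z \in x :: cover_path x y -> x <= z <= y.
Proof.
move=> xy z_in; apply/andP; split.
  by move: z_in; rewrite inE => /predU1P[->|/(cover_path_head xy)/ltW].
have [_ lastE] := cover_pathP xy.
by move: z_in; rewrite lastI lastE mem_rcons inE => /predU1P[->|/(cover_path_last xy)/ltW].
Qed.

Lemma size_cover_path k x y : x <= y -> chain_free k.+1 x y ->
  (size (cover_path x y) < k)%N.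
Proof.
move=> xy free_k; have lt_c := cover_path_lt xy.
have := @chain_free_size _ _ _ (x :: cover_path x y) free_k lt_c.
by apply; apply/allP=> z /(cover_path_between xy).
Qed.

(** Unlike standard examples, ladders allow every [p.1] to be raised and every
[p.2] to be lowered, as long as [p.1 <= q.2] persists: such moves preserve
[~~ (p.1 <= p.2)]. *)
Definition ladder k (s : seq (P * P)) :=
  (forall p, p \in s -> ~~ (p.1 <= p.2)) /\
  (forall p q, subseq [:: p; q] s -> p.1 <= q.2 /\ chain_free k p.1 q.2).

Lemma ladder_sub k s t : subseq t s -> ladder k s -> ladder k t.
Proof.
move=> ts [L1 L2]; split=> [p /(mem_subseq ts)/L1 // | p q pq].
by apply: L2; apply: subseq_trans ts.
Qed.

(** Each [p.1] is pushed up to a point [w p q] that depends on the next rung [q].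
The new lower end stays off its own [p.2] because it is above [p.1]; it is below
the upper end of the next rung by the second hypothesis, and below those further
away by the third. *)
Lemma ladder_raise k (w : P * P -> P * P -> P) p0 t : ladder k.+1 (p0 :: t) ->
  (forall p q, subseq [:: p; q] (p0 :: t) -> p.1 < w p q <= q.2) ->
  (forall p q r, subseq [:: p; q; r] (p0 :: t) -> w p q <= r.2) ->
  ladder k (pairmap (fun p q => (w p q, p.2)) p0 t).
Proof.
move=> [L1 L2] w2 w3; split=> [_ /mem_pairmap[p [q [-> pq]]] | u v].
  have /andP[lt_w _] := w2 _ _ pq.
  have /L1 : p \in p0 :: t by rewrite (mem_subseq pq) ?mem_head.
  by apply: contra => /= /(le_trans (ltW lt_w)).
move=> /subseq2_pairmap[p [q [r [r' [-> -> pq _ pqr]]]]].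
have /andP[lt_w le_w] := w2 _ _ pq.
have le_wr : w p q <= r.2 by case: pqr => [<-|[/w3]].
split=> //; apply: chain_free_raise lt_w le_wr _.
case: pqr => [<-|[pqr _]]; first by have [] := L2 _ _ pq.
have /L2[] // : subseq [:: p; r] (p0 :: t).
exact: subseq_trans (subseq_skip_middle p q r) pqr.
Qed.

(** The mirror image of [ladder_raise]: each [q.2] is pulled down to a point that
depends on the preceding rung, so this time the first rung is lost. *)
Lemma ladder_lower k (w : P * P -> P * P -> P) p0 t : ladder k.+1 (p0 :: t) ->
  (forall p q, subseq [:: p; q] (p0 :: t) -> p.1 <= w p q < q.2) ->
  (forall p q r, subseq [:: p; q; r] (p0 :: t) -> p.1 <= w q r) ->
  ladder k (pairmap (fun p q => (q.1, w p q)) p0 t).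
Proof.
move=> [L1 L2] w2 w3; split=> [_ /mem_pairmap[p [q [-> pq]]] | u v].
  have /andP[_ lt_w] := w2 _ _ pq.
  have /L1 : q \in p0 :: t by rewrite (mem_subseq pq) ?mem_head ?inE ?eqxx ?orbT.
  by apply: contra => /= /le_trans-> //; apply: ltW.
move=> /subseq2_pairmap[p [q [r [r' [-> -> pq rr' qrr']]]]].
have /andP[le_w lt_w] := w2 _ _ rr'.
have le_qw : q.1 <= w r r' by case: qrr' => [->|[_ /w3]].
split=> //; apply: chain_free_lower lt_w le_qw _.
case: qrr' => [->|[_ qrr']]; first by have [] := L2 _ _ rr'.
have /L2[] // : subseq [:: q; r'] (p0 :: t).
exact: subseq_trans (subseq_skip_middle q r r') qrr'.
Qed.
End Chains.

(** * Long ladders yield complete topological minors *)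

Section Untangled.
Variables (disp : Order.disp_t) (P : finPOrderType disp).
Local Notation path_of p q := (cover_path p.1 q.2).

(** The outcome of Ramsey's theorem in which no end of the ladder can be moved. *)
Definition untangled (t : seq (P * P)) := forall p q r, subseq [:: p; q; r] t ->
  (forall z, z \in path_of p q -> ~~ (z <= r.2)) /\
  (forall z, z \in belast q.1 (path_of q r) -> ~~ (p.1 <= z)).

(** Take the first [n] rungs for lower ends and the rungs after index [n] for upper
ends.  Suppose that z lies on the paths from X u to Y j and from X u' to Y j'.
If j < j', then z <= Y j' forces z = X u; symmetrically, if u < u', then
X u <= z forces z = Y j'.  Both at once would give X u = Y j'.  If u < u' and
j' < j, then z = Y j' would be a vertex of the path from X u to Y j' lying below
Y j, which is excluded as well. *)
Lemma untangled_topological_minor k n (t : seq (P * P)) : ladder k t -> untangled t ->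
  (n.+1 + #|{: 'I_n * 'I_n}| <= size t)%N ->
  topological_minor (complete_graph n) (cover_graph P).
Proof.
case: t => [|p0 t']; first by rewrite addSn.
set t := p0 :: t' => [[L1 L2]] U sz_t.
pose a i := nth p0 t i; pose X i := (a i).1; pose Y i := (a i).2.
pose c i j := cover_path (X i) (Y j).
have a_sub js : sorted ltn js -> all (gtn (size t)) js -> subseq (map a js) t.
  exact: subseq_nth.
have le_XY i j : (i < j < size t)%N -> X i <= Y j.
  move=> /andP[ij jt]; apply: (proj1 (L2 (a i) (a j) _)).
  by apply: (a_sub [:: i; j]); rewrite /= ?ij ?jt ?(ltn_trans ij jt).
have sub3 i j l : (i < j)%N -> (j < l)%N -> (l < size t)%N -> subseq [:: a i; a j; a l] t.
  move=> ij jl lt; have jt := ltn_trans jl lt.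
  by apply: (a_sub [:: i; j; l]); rewrite /= ?ij ?jl ?lt ?jt ?(ltn_trans ij jt).
have cY i j l z : (i < j)%N -> (j < l)%N -> (l < size t)%N -> z \in c i j -> ~~ (z <= Y l).
  by move=> ij jl lt; apply: (proj1 (U _ _ _ (sub3 _ _ _ ij jl lt))).
have cX i j l z : (i < j)%N -> (j < l)%N -> (l < size t)%N ->
    z \in belast (X j) (c j l) -> ~~ (X i <= z).
  by move=> ij jl lt; apply: (proj2 (U _ _ _ (sub3 _ _ _ ij jl lt))).
(* Hubs are indexed by ordered pairs, numbered by their rank.  Rung n is skipped:
   it lies strictly between the lower and the upper rungs, and this separates
   each lower end from each upper end. *)
pose y (j : 'I_n * 'I_n) : nat := (n.+1 + enum_rank j)%N.
have y_t j : (y j < size t)%N.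
  by apply: leq_trans sz_t; rewrite ltn_add2l ltn_ord.
have ny j : (n < y j)%N by rewrite /y addSn ltnS leq_addr.
have uy (u : 'I_n) j : (u < y j)%N by apply: ltn_trans (ny j).
have le_xy (u : 'I_n) j : X u <= Y (y j) by rewrite le_XY // uy y_t.
have neq_xy (u : 'I_n) j : X u != Y (y j).
  have nt : (n < size t)%N := ltn_trans (ny j) (y_t j).
  have : ~~ (X n <= Y n) by apply: L1; apply: mem_nth.
  apply: contra => /eqP eq_xy; apply: (@le_trans _ _ (Y (y j))).
    by rewrite le_XY // ny y_t.
  by rewrite -eq_xy le_XY // ltn_ord.
(* The interior of the path; removing both ends is possible as they differ. *)
pose e (u : 'I_n) j := behead (belast (X u) (c u (y j))).
have eE (u : 'I_n) j : c u (y j) = rcons (e u j) (Y (y j)).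
  rewrite /e; have [_] := cover_pathP (le_xy u j); rewrite -/(c _ _).
  case: (c _ _) => [/eqP|z s /= <-]; first by rewrite (negbTE (neq_xy u j)).
  by rewrite -lastI.
have belE (u : 'I_n) j : belast (X u) (c u (y j)) = X u :: e u j.
  by rewrite eE belast_rcons.
have in_Y (u : 'I_n) j z : z \in X u :: rcons (e u j) (Y (y j)) -> z <= Y (y j).
  by rewrite -eE => /(cover_path_between (le_xy u j))/andP[].
have in_X (u : 'I_n) j z : z \in X u :: rcons (e u j) (Y (y j)) -> X u <= z.
  by rewrite -eE => /(cover_path_between (le_xy u j))/andP[].
have hitY (u : 'I_n) j j' z : (y j < y j')%N -> z \in X u :: rcons (e u j) (Y (y j)) ->
    z <= Y (y j') -> z = X u.
  move=> jj'; rewrite -eE inE => /predU1P[//|z_c] z_le.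
  by have := cY _ _ _ _ (uy u j) jj' (y_t j') z_c; rewrite z_le.
have hitX (u u' : 'I_n) j z : (u < u')%N -> z \in X u' :: rcons (e u' j) (Y (y j)) ->
    X u <= z -> z = Y (y j).
  move=> uu'; rewrite -rcons_cons mem_rcons inE -belE => /predU1P[//|z_c] z_ge.
  by have := cX _ _ _ _ uu' (uy u' j) (y_t j) z_c; rewrite z_ge.
have y_inj j j' : y j = y j' -> j = j' by move=> /addnI/val_inj/enum_rank_inj.
pose h (u v : 'I_n) := if (u <= v)%N then (u, v) else (v, u).
apply: (@subdivided_biclique_topological_minor (cover_graph P) n
  ('I_n * 'I_n)%type (fun u => X u) (fun j => Y (y j)) e h).
- by move=> u v; rewrite /h; case: (ltngtP u v) => // /val_inj->.
- by move=> u v u' v'; rewrite /h; do 2![case: ifP => _] => -[-> ->]; auto.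
- move=> u j; rewrite -eE; have [+ _] := cover_pathP (le_xy u j).
  by apply: sub_path => z s zs; rewrite /= /cover_adj zs.
- by move=> u j; rewrite -eE; apply: lt_sorted_uniq; apply: (cover_path_lt (le_xy u j)).
have disj (u u' : 'I_n) j j' z : (u < u')%N ->
    z \in X u :: rcons (e u j) (Y (y j)) ->
    z \in X u' :: rcons (e u' j') (Y (y j')) -> j = j' /\ z = Y (y j).
  move=> uu' z1 z2; have zY : z = Y (y j') by apply: hitX uu' z2 (in_X _ _ _ z1).
  case: (ltngtP (y j) (y j')) => [jj'|j'j|/y_inj->] //.
    have zX := hitY _ _ _ _ jj' z1 (in_Y _ _ _ z2).
    by have := neq_xy u j'; rewrite -zX -zY eqxx.
  have z_far : ~~ (z <= Y (y j)).
    apply: (cY _ _ _ _ (uy u j') j'j (y_t j)).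
    by rewrite eE zY mem_rcons mem_head.
  by rewrite (in_Y _ _ _ z1) in z_far.
move=> u j u' j' z z1 z2; case: (ltngtP u u') => [uu'|u'u|/val_inj eq_u].
- by constructor 3; apply: disj uu' z1 z2.
- by constructor 3; have [-> ->] := disj _ _ _ _ _ u'u z2 z1.
rewrite -eq_u in z2 *.
case: (ltngtP (y j) (y j')) => [jj'|j'j|/y_inj->]; last by constructor 1.
  by constructor 2; rewrite (hitY _ _ _ _ jj' z1 (in_Y _ _ _ z2)).
by constructor 2; rewrite (hitY _ _ _ _ j'j z2 (in_Y _ _ _ z1)).
Qed.
End Untangled.

Lemma long_ladder_topological_minor n k : exists N,
  forall (disp : Order.disp_t) (P : finPOrderType disp) (s : seq (P * P)),
  ladder k s -> (N <= size s)%N ->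
  topological_minor (complete_graph n) (cover_graph P).
Proof.
elim: k => [|k [M IHM]].
  (* Every interval contains the empty chain, so a ladder with k = 0 has at most
     one rung. *)
  exists 2 => disp P [|p [|q s]] // [_ L2] _.
  have [|_] := L2 p q; first by rewrite /= !eqxx sub0seq.
  by move=> /(@chain_free_size _ _ _ _ _ [::])-/(_ isT isT).
have [N ramseyN] := @ramsey (option 'I_k * option 'I_k)%type 3
  (maxn M.+2 (n.+1 + #|{: 'I_n * 'I_n}|)).
exists N => disp P s Ls le_s.
pose c (p q : P * P) := cover_path p.1 q.2.
(* The positions below are bounded by k because c p q together with its starting
   point is a chain in an interval without k + 1 point chains. *)
pose early (p q r : P * P) i := (i < size (c p q))%N && (nth p.1 (c p q) i <= r.2).
pose late (p q r : P * P) i := (i < size (c q r))%N && (p.1 <= nth q.1 (belast q.1 (c q r)) i).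
pose f (u : seq (P * P)) : option 'I_k * option 'I_k :=
  if u is [:: p; q; r] then ([pick i : 'I_k | early p q r i], [pick i : 'I_k | late p q r i])
  else (None, None).
have [t [col [t_s sz_t ft]]] := ramseyN _ f s le_s.
have {t_s Ls} Lt := ladder_sub t_s Ls.
have {}ft p q r : subseq [:: p; q; r] t ->
    ([pick i : 'I_k | early p q r i], [pick i : 'I_k | late p q r i]) = col.
  by move=> pqr; apply: (ft _ pqr erefl).
have le_pq (p q : P * P) : subseq [:: p; q] t -> p.1 <= q.2 by case: Lt => _ /[apply]-[].
have c_size p q : subseq [:: p; q] t -> (size (c p q) < k)%N.
  by case: Lt => _ /[apply]-[]; apply: size_cover_path.
have [sz1 sz2] : (M.+1 < size t)%N /\ (n.+1 + #|{: 'I_n * 'I_n}| <= size t)%N.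
  by apply/andP; rewrite sz_t -geq_max.
have sub12 (p q r : P * P) : subseq [:: p; q; r] t -> subseq [:: p; q] t.
  by apply: subseq_trans; apply: (prefix_subseq [:: p; q] [:: r]).
have sub23 (p q r : P * P) : subseq [:: p; q; r] t -> subseq [:: q; r] t.
  by apply: subseq_trans; apply: subseq_cons.
have early_col i co p q r : col = (Some i, co) -> subseq [:: p; q; r] t -> early p q r i.
  by move=> eq_col /ft; rewrite eq_col => -[]; case: pickP => // i' + [<-].
have late_col i co p q r : col = (co, Some i) -> subseq [:: p; q; r] t -> late p q r i.
  by move=> eq_col /ft; rewrite eq_col => -[_]; case: pickP => // i' + [<-].
case: col ft early_col late_col => [[i|] co] ft early_col late_col;
  last case: co => [j|] in ft early_col late_col *; last first.
- apply: (untangled_topological_minor Lt _ sz2) => p q r pqr.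
  have [] := ft _ _ _ pqr; case: pickP => // no_early _; case: pickP => // no_late _.
  split=> z z_in; apply/negP=> z_le.
    have sz_z : (index z (c p q) < size (c p q))%N by rewrite index_mem.
    have := no_early (Ordinal (ltn_trans sz_z (c_size _ _ (sub12 _ _ _ pqr)))).
    by rewrite /early /= sz_z nth_index // z_le.
  have sz_z : (index z (belast q.1 (c q r)) < size (c q r))%N.
    by rewrite -[X in (_ < X)%N](size_belast q.1) index_mem.
  have := no_late (Ordinal (ltn_trans sz_z (c_size _ _ (sub23 _ _ _ pqr)))).
  by rewrite /late /= sz_z nth_index // z_le.
all: suff [s' Ls' sz_s'] : exists2 s' : seq (P * P), ladder k s' & (M <= size s')%N
  by exact: IHM Ls' sz_s'.
(* The first rung o is dropped: it turns every pair of rungs into a triple whose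
   colour provides the position j. *)
- case: t => [//|o [//|p0 t]] in Lt le_pq sz1 late_col
    {ft c_size sub12 sub23 sz_t sz2 early_col} *.
  pose w q r := nth q.1 (belast q.1 (c q r)) j.
  exists (pairmap (fun q r => (r.1, w q r)) p0 t); last by rewrite size_pairmap.
  apply: ladder_lower => [|q r qr|p q r pqr].
  + exact: ladder_sub (subseq_cons _ _) Lt.
  + have oqr : subseq [:: o; q; r] [:: o, p0 & t] by rewrite /= eqxx.
    have /andP[sz_j _] := late_col _ _ _ _ _ erefl oqr.
    have w_in : w q r \in belast q.1 (c q r) by rewrite mem_nth ?size_belast.
    have le_qr : q.1 <= r.2 by apply: le_pq; apply: subseq_trans qr (subseq_cons _ _).
    rewrite (cover_path_last le_qr w_in) andbT.
    by have /andP[] := cover_path_between le_qr (mem_belast w_in).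
  have /(late_col _ _ _ _ _ erefl)/andP[] // : subseq [:: p; q; r] [:: o, p0 & t].
  exact: subseq_trans pqr (subseq_cons _ _).
(* Here the last rung o is dropped, to complete pairs to triples on the right. *)
case/lastP: t => [//|[//|p0 t] o] in Lt le_pq sz1 early_col
  {ft c_size sub12 sub23 sz_t sz2 late_col} *.
have sub_t : subseq (p0 :: t) (rcons (p0 :: t) o) by apply: subseq_rcons.
pose w p q := nth p.1 (c p q) i.
exists (pairmap (fun p q => (w p q, p.2)) p0 t).
  2: by move: sz1; rewrite size_pairmap size_rcons.
apply: ladder_raise => [|p q pq|p q r pqr].
- exact: ladder_sub sub_t Lt.
- have pqo : subseq [:: p; q; o] (rcons (p0 :: t) o).
    by rewrite -[[:: p; q; o]]/(rcons [:: p; q] o) -!cats1 cat_subseq.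
  have /andP[sz_i _] := early_col _ _ _ _ _ erefl pqo.
  have w_in : w p q \in c p q by rewrite mem_nth.
  have le_pq' : p.1 <= q.2 by apply: le_pq; apply: subseq_trans pq sub_t.
  rewrite (cover_path_head le_pq' w_in) /=.
  by have /andP[] := cover_path_between le_pq' (mem_behead (s := _ :: _) w_in).
have /(early_col _ _ _ _ _ erefl)/andP[] // : subseq [:: p; q; r] (rcons (p0 :: t) o).
exact: subseq_trans pqr sub_t.
Qed.

(** * Standard examples in posets without two long incomparable chains *)

(** A point c between [a] and [b'] and a point c' between [a'] and [b] are
incomparable: c <= c' gives [a <= b], and c' <= c gives [a' <= b']. *)
Lemma kk_free_chain_free (disp : Order.disp_t) (P : finPOrderType disp) k (a a' b b' : P) :
  kk_free k P -> ~~ (a <= b) -> ~~ (a' <= b') -> chain_free k a b' || chain_free k a' b.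
Proof.
move=> kkP ab a'b'; rewrite -negb_and; apply/negP.
case/andP=> /existsP[c /andP[c_lt c_in]] /existsP[c' /andP[c'_lt c'_in]]; apply: kkP.
have tnth_lt (s : k.-tuple P) : sorted <%O s ->
    forall i j : 'I_k, (i < j)%N -> tnth s i < tnth s j.
  move=> s_lt i j ij; rewrite !(tnth_nth a).
  by rewrite lt_sorted_ltn_nth ?inE ?size_tuple.
exists (tnth c), (tnth c'); split; [exact: tnth_lt | split; first exact: tnth_lt].
move=> i j; have /andP[c1 c2] := allP c_in _ (mem_tnth i c).
have /andP[c'1 c'2] := allP c'_in _ (mem_tnth j c').
apply/negP; case/orP=> [cc'|c'c].
  by case/negP: ab; apply: le_trans c1 (le_trans cc' c'2).
by case/negP: a'b'; apply: le_trans c'1 (le_trans c'c c2).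
Qed.

Theorem theorem3 :
  forall k n : nat, (2 <= k)%N -> (1 <= n)%N ->
  exists m : nat,
  forall (disp : Order.disp_t) (P : finPOrderType disp),
    kk_free k P ->
    ~ topological_minor (complete_graph n) (cover_graph P) ->
    forall d : nat, (0 < d)%N ->
      contains_subposet (std_example d) P -> (d <= m)%N.
Proof.
move=> k n _ _; have [M ladderM] := long_ladder_topological_minor n k.
have [N ramseyN] := @ramsey bool 2 M.
exists N => disp P kkP no_minor d _ [g _ g_mono]; rewrite leqNgt; apply/negP=> lt_Nd.
case: no_minor; pose a i := g (inl i); pose b i := g (inr i).
have ab i j : (a i <= b j) = (i != j) by rewrite /a /b g_mono le_eqVlt.
pose f (u : seq 'I_d) := if u is [:: i; j] then chain_free k (a i) (b j) else true.
have [|t [col [t_sub sz_t ft]]] := ramseyN _ f (enum 'I_d).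
  by rewrite size_enum_ord ltnW.
have neq i j : subseq [:: i; j] t -> i != j.
  move=> ij; have := subseq_uniq (subseq_trans ij t_sub) (enum_uniq _).
  by rewrite /= inE andbT.
have ladder_map s : size s = M ->
    (forall i j, subseq [:: i; j] s -> i != j /\ chain_free k (a i) (b j)) ->
    topological_minor (complete_graph n) (cover_graph P).
  move=> sz_s free_s; apply: (ladderM _ _ [seq (a i, b i) | i <- s]).
    split=> [_ /mapP[i _ ->] | p q]; first by rewrite ab eqxx.
    move=> /subseqP[m]; rewrite size_map -map_mask => _ pq.
    have := mask_subseq m s; case: (mask m s) pq => [|i [|j []]] //= [-> ->] ij.
    by have [ne_ij free_ij] := free_s _ _ ij; rewrite ab.
  by rewrite size_map sz_s.
case: col ft => ft.
  by apply: (ladder_map t) => // i j ij; split; [exact: neq | exact: (ft _ ij erefl)].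
apply: (ladder_map (rev t)) => [|i j]; first by rewrite size_rev.
(* Long intervals from a_i to b_j for i before j mean short ones from a_j to
   b_i, so the reversed sequence is a ladder. *)
rewrite -[[:: i; j]]/(rev [:: j; i]) subseq_rev => ji; split; first by rewrite eq_sym neq.
have := @kk_free_chain_free _ P k (a j) (a i) (b j) (b i) kkP.
by rewrite !ab !eqxx => /(_ isT isT); rewrite [chain_free k (a j) _](ft _ ji erefl).
Qed.
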